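(* Consider the planar system $x'=|x|-|y|+\lambda\varepsilon,\ y'=\varepsilon$ with $\lambda=1$ and $\varepsilon>0$. The attracting branch $\mathcal{S}_{a,\varepsilon}^-$ and the repelling branch $\mathcal{S}_{r,\varepsilon}^+$ of the slow manifold connect at the origin; therefore, the maximal delay is unbounded (the orbit continuing $\mathcal{S}_{a,\varepsilon}^-$ never leaves a tubular neighbourhood of the slow manifold). Moreover, let $N(\delta)$ be the tubular neighbourhood of radius $\delta$, with $\delta>2\varepsilon$, of the slow manifold $\mathcal{S}_{a,\varepsilon}^-\cup\mathcal{S}_{r,\varepsilon}^+$. Then the graph of the way-in/way-out function is located between the lines $y=x+\delta$ and $y=x-\delta$; that is, if an orbit enters $N(\delta)$ at a point with ordinate $y_i$ and leaves $N(\delta)$ at a point with ordinate $y_o$, then $|y_i|-\delta\le y_o\le |y_i|+\delta$. Consequently, the way-in/way-out function tends to infinity as $|y_i|\to\infty$ and therefore is not bounded.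
   Context: For the system $x'=|x|-|y|+\lambda\varepsilon,\ y'=\varepsilon$ the relevant canonical slow manifolds are $$\mathcal{S}_{a,\varepsilon}^-=\{(x,y): y=x+\varepsilon(1-\lambda),\ x<\min\{0,\varepsilon(\lambda-1)\}\},$$ $$\mathcal{S}_{r,\varepsilon}^+=\{(x,y): y=x-\varepsilon(1-\lambda),\ x>\max\{0,\varepsilon(1-\lambda)\}\}.$$ For $\lambda=1$ both lie on the line $y=x$. The tubular neighbourhood of radius $\delta$ is $N(\delta)=\{(x,y):|y-x|<\delta\}$ (offset measured vertically). Orbits enter $N(\delta)$ along the attracting branch, i.e. at points $\mathbf{p}_i=(x_i,y_i)$ with $x_i<0$, $y_i<0$ and $y_i=x_i\pm\delta$; $\mathbf{p}_o=(x_o,y_o)$ denotes the point at which the orbit subsequently leaves $N(\delta)$. The way-in/way-out function is the relation $y_o=\mathcal{Z}(|y_i|)$ between these ordinates. The maximal delay is the ordinate at which the orbit through the end point $\mathbf{p}_a^-$ of $\mathcal{S}_{a,\varepsilon}^-$ (the origin when $\lambda=1$) leaves the tubular neighbourhood (the asymptotic value of $\mathcal{Z}$ as $|y_i|\to\infty$); it is unbounded if that orbit never leaves. *)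

(* Defs.v *)
From Stdlib Require Import Reals.
From Coquelicot Require Import Coquelicot.
Open Scope R_scope.

(* The vector field is globally Lipschitz, so its maximal solutions are exactly
   the solutions defined on the whole line. *)
Definition is_solution (eps lam : R) (g : R -> R * R) : Prop :=
  forall t : R,
    is_derive (fun u => fst (g u)) t
      (Rabs (fst (g t)) - Rabs (snd (g t)) + lam * eps) /\
    is_derive (fun u => snd (g u)) t eps.

Definition orbit (eps lam : R) (p q : R * R) : Prop :=
  exists (g : R -> R * R) (t : R),
    is_solution eps lam g /\ g 0 = p /\ g t = q.

Definition Sa_minus (eps lam : R) (p : R * R) : Prop :=
  snd p = fst p + eps * (1 - lam) /\ fst p < Rmin 0 (eps * (lam - 1)).

Definition Sr_plus (eps lam : R) (p : R * R) : Prop :=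
  snd p = fst p - eps * (1 - lam) /\ fst p > Rmax 0 (eps * (1 - lam)).

(* The branches are half-lines without their extremity, so the end point is
   what the closure adds. *)
Definition end_point (S : R * R -> Prop) (p : R * R) : Prop :=
  ~ S p /\
  forall P : R * R -> Prop, locally p P -> exists q : R * R, P q /\ S q.

(* Centred on the line y = x, which contains both branches when [lam = 1]; the
   radius is measured vertically. *)
Definition tube (delta : R) (p : R * R) : Prop :=
  Rabs (snd p - fst p) < delta.

(* [g], followed from time [ti], is first outside the open tube at time [tf];
   whether [g ti] itself lies in the tube or on its boundary is left open. *)
Definition leaves_at (delta : R) (g : R -> R * R) (ti tf : R) : Prop :=
  ti < tf /\
  (forall t : R, ti < t < tf -> tube delta (g t)) /\
  ~ tube delta (g tf).

(* [Glb_Rbar] of the empty set is [p_infty]: the delay is infinite when the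
   orbit through the end point never leaves the tube. *)
Definition maximal_delay (eps lam delta : R) : Rbar :=
  Glb_Rbar (fun y => exists (p : R * R) (g : R -> R * R) (t : R),
    end_point (Sa_minus eps lam) p /\
    is_solution eps lam g /\ g 0 = p /\
    leaves_at delta g 0 t /\ y = snd (g t)).

(* The signed offset [d] is [delta] or [- delta] and selects the side of the
   tube through which the orbit enters. *)
Definition entry_point (d : R) (p : R * R) : Prop :=
  fst p < 0 /\ snd p < 0 /\ snd p = fst p + d.

Definition passage (eps lam delta d yi yo : R) : Prop :=
  exists (g : R -> R * R) (ti tf : R),
    is_solution eps lam g /\
    entry_point d (g ti) /\ leaves_at delta g ti tf /\
    snd (g ti) = yi /\ snd (g tf) = yo.

Definition entry_domain (d a : R) : Prop :=
  exists p : R * R, entry_point d p /\ a = Rabs (snd p).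

(* Orbits entering at the same ordinate through the two sides of the tube may
   leave it at different ordinates, so there is one function for each side. *)
Definition is_way_in_way_out (eps lam delta d : R) (Z : R -> R) : Prop :=
  forall a b : R,
    (exists yi : R, a = Rabs yi /\ passage eps lam delta d yi b) <->
    (entry_domain d a /\ b = Z a).

(* Main.v *)
Require Import Defs.
From Stdlib Require Import Reals Lra.
From Coquelicot Require Import Coquelicot.
From Stdlib Require Import Classical ClassicalEpsilon.
Open Scope R_scope.

(** In units of [eps], with the ordinate [z = y / eps] as time, the offset
    [V = (y - x) / eps] solves [V' = |z| - |z - V|]. Zero is a solution, which
    is the connection of the two branches at the origin. The right-hand side is
    bounded by [|V|], so an orbit leaving at offset [D = delta / eps] cannot
    have entered at a larger [|z|] than it leaves at (on the side [V > 0]).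
    In the other direction, a positive solution is [u0 exp (- z)] up to
    [z = 0], and then one of two things happens. Either it stays above the
    diagonal [V = z], hence leaves before [z = D]; or it meets the diagonal at
    some [s < 1], where [u0 <= s], and from there grows like [s exp (z - s)]: it
    leaves at most [s] later than the entry ordinate, unless it first crosses
    the diagonal again, and then it leaves before [z = D]. The side [V < 0]
    follows from the reversal [V z -> - V (- z)]. *)

(** * Exponential inequalities and a two-sided Gronwall estimate *)

Lemma exp_mul_opp (x : R) : exp x * exp (- x) = 1.
Proof. rewrite <- exp_plus, Rplus_opp_r. apply exp_0. Qed.

Lemma exp_tangent (y z : R) : exp y * (1 + (z - y)) <= exp z.
Proof.
  replace (exp z) with (exp y * exp (z - y)) by (rewrite <- exp_plus; f_equal; ring).
  apply Rmult_le_compat_l; [left; apply exp_pos | apply exp_ineq1_le].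
Qed.

(** Weighted sum of the tangent inequalities at [y]; the form cleared of the denominator [q - p]
    also covers [p = q]. *)
Lemma exp_chord (p y q : R) : p <= y <= q ->
  (q - p) * exp y <= (q - y) * exp p + (y - p) * exp q.
Proof.
  intros H.
  assert (Hp := exp_tangent y p). assert (Hq := exp_tangent y q).
  apply (Rmult_le_compat_l (q - y)) in Hp; [|lra].
  apply (Rmult_le_compat_l (y - p)) in Hq; [|lra].
  lra.
Qed.

Lemma nondecreasing_of_derive (f df : R -> R) (a b : R) :
  a <= b -> (forall t, a <= t <= b -> is_derive f t (df t)) ->
  (forall t, a <= t <= b -> 0 <= df t) -> f a <= f b.
Proof.
  intros Hab Hd Hp.
  destruct (MVT_gen f a b df) as [c [Hc E]];
    rewrite ?Rmin_left, ?Rmax_right in * by lra.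
  - intros x Hx; apply Hd; lra.
  - intros x Hx. apply derivable_continuous_pt. exists (df x).
    apply is_derive_Reals, Hd; lra.
  - assert (0 <= df c * (b - a)) by (apply Rmult_le_pos; [apply Hp|]; lra). lra.
Qed.

(** Since [|w w'| <= w^2], the square of [w exp (- t)] is nonincreasing and that of [w exp t] is
    nondecreasing. Squares avoid differentiating an absolute value, and the two directions serve
    uniqueness forwards and backwards. *)
Lemma gronwall (w dw : R -> R) :
  (forall t, is_derive w t (dw t)) -> (forall t, Rabs (dw t) <= Rabs (w t)) ->
  forall s t, s <= t ->
    Rabs (w t) <= Rabs (w s) * exp (t - s) /\ Rabs (w s) <= Rabs (w t) * exp (t - s).
Proof.
  intros Hd Hl s t Hst.
  assert (Hb : forall r, - (w r * w r) <= w r * dw r <= w r * w r).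
  { intros r. apply Rabs_le_between. rewrite Rabs_mult.
    rewrite <- (Rabs_pos_eq (w r * w r)), Rabs_mult by apply Rle_0_sqr.
    apply Rmult_le_compat_l; [apply Rabs_pos | apply Hl]. }
  assert (Hex : forall r, ex_derive w r) by (intros r; eexists; apply Hd).
  assert (HD : forall r, Derive w r = dw r) by (intros r; apply is_derive_unique, Hd).
  assert (Hpos : forall r, 0 < exp r * exp r)
    by (intros r; apply Rmult_lt_0_compat; apply exp_pos).
  assert (Hexp : forall a b x y, Rsqr (x * exp a) <= Rsqr (y * exp b) ->
            Rabs x <= Rabs y * exp (b - a)).
  { intros a b x y H. apply Rsqr_le_abs_0 in H. rewrite !Rabs_mult in H.
    rewrite !(Rabs_pos_eq (exp _)) in H by (left; apply exp_pos).
    apply (Rmult_le_reg_r (exp a)); [apply exp_pos|].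
    rewrite Rmult_assoc, <- exp_plus. now replace (b - a + a) with b by ring. }
  split.
  - replace (t - s) with (- s - - t) by ring. apply Hexp, Ropp_le_cancel.
    apply (nondecreasing_of_derive (fun r => - Rsqr (w r * exp (- r)))
             (fun r => 2 * (w r * w r - w r * dw r) * (exp (- r) * exp (- r)))).
    + exact Hst.
    + intros r _. unfold Rsqr. auto_derive; [auto|]. rewrite HD. ring.
    + intros r _. specialize (Hb r). specialize (Hpos (- r)).
      apply Rmult_le_pos; lra.
  - apply Hexp.
    apply (nondecreasing_of_derive (fun r => Rsqr (w r * exp r))
             (fun r => 2 * (w r * w r + w r * dw r) * (exp r * exp r))).
    + exact Hst.
    + intros r _. unfold Rsqr. auto_derive; [auto|]. rewrite HD. ring.
    + intros r _. specialize (Hb r). specialize (Hpos r).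
      apply Rmult_le_pos; lra.
Qed.

(** * The offset equation: uniqueness, growth and reversal *)

Definition offset_sol (V : R -> R) : Prop :=
  forall z, is_derive V z (Rabs z - Rabs (z - V z)).

Lemma offset_field_lipschitz (z v w : R) :
  Rabs ((Rabs z - Rabs (z - v)) - (Rabs z - Rabs (z - w))) <= Rabs (v - w).
Proof.
  replace (Rabs z - Rabs (z - v) - (Rabs z - Rabs (z - w)))
    with (Rabs (z - w) - Rabs (z - v)) by ring.
  eapply Rle_trans; [apply Rabs_triang_inv2|]. right. f_equal. ring.
Qed.

(** The field is 1-Lipschitz in the offset, so the Gronwall estimate applies to [V - W], which
    vanishes at [c]. *)
Lemma offset_sol_unique (V W : R -> R) (c : R) :
  offset_sol V -> offset_sol W -> V c = W c -> forall z, V z = W z.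
Proof.
  intros HV HW Hc z.
  assert (G := gronwall (fun t => V t - W t)
    (fun t => (Rabs t - Rabs (t - V t)) - (Rabs t - Rabs (t - W t)))
    (fun t => is_derive_minus V W t _ _ (HV t) (HW t))
    (fun t => offset_field_lipschitz t (V t) (W t))).
  cbv beta in G.
  assert (E : V c - W c = 0) by lra.
  assert (K : Rabs (V z - W z) <= 0).
  { destruct (Rle_dec c z) as [H|H].
    - destruct (G c z H) as [K _]. rewrite E, Rabs_R0 in K. lra.
    - destruct (G z c ltac:(lra)) as [_ K]. rewrite E, Rabs_R0 in K. lra. }
  assert (K' := Rabs_pos (V z - W z)).
  destruct (Req_dec (V z - W z) 0) as [H|H]; [lra|].
  apply Rabs_pos_lt in H. lra.
Qed.

Lemma offset_sol_zero : offset_sol (fun _ => 0).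
Proof.
  intros z. replace (Rabs z - Rabs (z - 0)) with 0 by (rewrite Rminus_0_r; ring).
  apply (is_derive_const (K := R_AbsRing) (V := R_NormedModule) 0).
Qed.

Lemma offset_growth (V : R -> R) (s t : R) : offset_sol V -> s <= t ->
  Rabs (V t) <= Rabs (V s) * exp (t - s).
Proof.
  intros HV H. apply (gronwall V (fun r => Rabs r - Rabs (r - V r)) HV); [|exact H].
  intros r. assert (L := offset_field_lipschitz r (V r) 0).
  rewrite Rminus_0_r, Rminus_diag in L. now rewrite !Rminus_0_r in L.
Qed.

Lemma offset_sol_rev (V : R -> R) : offset_sol V -> offset_sol (fun z => - V (- z)).
Proof.
  intros HV z.
  assert (HD : forall r, Derive V r = Rabs r - Rabs (r - V r))
    by (intros r; apply is_derive_unique, HV).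
  auto_derive; [eexists; apply HV|].
  rewrite HD, Rabs_Ropp.
  replace (- z - V (- z)) with (- (z - - V (- z))) by ring.
  rewrite Rabs_Ropp. ring.
Qed.

(** * Gluing, explicit branches and first hitting times *)

(** Both pieces solve the same equation and agree at [c], so their slopes agree there too and no
    separate matching of derivatives is required. *)
Lemma is_derive_glue (F : R -> R -> R) (f g : R -> R) (c t : R) :
  (t <= c -> is_derive f t (F t (f t))) ->
  (c <= t -> is_derive g t (F t (g t))) ->
  f c = g c ->
  is_derive (fun r => if Rle_dec r c then f r else g r) t
    (F t (if Rle_dec t c then f t else g t)).
Proof.
  intros Hf Hg E. destruct (total_order_T t c) as [[H|H]|H].
  - destruct (Rle_dec t c) as [_|?]; [|lra].
    apply is_derive_ext_loc with f; [|apply Hf; lra].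
    apply (filter_imp (fun r => r < c)); [|apply open_lt; exact H].
    intros r Hr. destruct (Rle_dec r c); [reflexivity|lra].
  - subst c. specialize (Hf (Rle_refl _)). specialize (Hg (Rle_refl _)).
    destruct (Rle_dec t t) as [_|?]; [|lra].
    rewrite <- E in Hg.
    apply is_derive_Reals in Hf. apply is_derive_Reals in Hg. apply is_derive_Reals.
    intros e He. destruct (Hf e He) as [d1 H1]. destruct (Hg e He) as [d2 H2].
    exists (mkposreal (Rmin d1 d2) (Rmin_stable_in_posreal d1 d2)). simpl.
    intros h Hh0 Hh.
    destruct (Rle_dec t t) as [_|?]; [|lra].
    destruct (Rle_dec (t + h) t).
    + apply H1; [exact Hh0|]. eapply Rlt_le_trans; [exact Hh | apply Rmin_l].
    + rewrite <- E in H2. apply H2; [exact Hh0|]. eapply Rlt_le_trans; [exact Hh | apply Rmin_r].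
  - destruct (Rle_dec t c) as [?|_]; [lra|].
    apply is_derive_ext_loc with g; [|apply Hg; lra].
    apply (filter_imp (fun r => c < r)); [|apply open_gt; exact H].
    intros r Hr. destruct (Rle_dec r c); [lra|reflexivity].
Qed.

(** For [V >= 0] the signs of [z] and [z - V] give three linear equations: [V' = - V] when [z <= 0],
    [V' = 2 z - V] when [0 <= z <= V], and [V' = V] when [V <= z]. This lemma and the next two
    record their solutions. *)
Lemma is_derive_decay_branch (A z : R) : z <= 0 -> 0 <= A ->
  is_derive (fun r => A * exp (- r)) z (Rabs z - Rabs (z - A * exp (- z))).
Proof.
  intros Hz HA. assert (0 <= A * exp (- z)) by (apply Rmult_le_pos; [exact HA | left; apply exp_pos]).
  rewrite !Rabs_left1 by lra. auto_derive; [auto | ring].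
Qed.

Lemma is_derive_middle_branch (C z : R) :
  0 <= z <= 2 * (z - 1) + C * exp (- z) ->
  is_derive (fun r => 2 * (r - 1) + C * exp (- r)) z
    (Rabs z - Rabs (z - (2 * (z - 1) + C * exp (- z)))).
Proof.
  intros Hz. rewrite Rabs_pos_eq, Rabs_left1 by lra. auto_derive; [auto | ring].
Qed.

Lemma is_derive_growth_branch (B z : R) : 0 <= B * exp z <= z ->
  is_derive (fun r => B * exp r) z (Rabs z - Rabs (z - B * exp z)).
Proof.
  intros Hz. rewrite !Rabs_pos_eq by lra. auto_derive; [auto | ring].
Qed.

(** [b] is the supremum of the times up to which [f] has stayed below [K]; if [f b < K], continuity
    would push the supremum further. *)
Lemma first_hitting (f : R -> R) (p q K : R) :
  (forall x, continuous f x) -> p < q -> f p < K -> K <= f q ->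
  exists b, p < b <= q /\ (forall z, p <= z < b -> f z < K) /\ K <= f b.
Proof.
  intros Hc Hpq Hp Hq.
  assert (Hopen : forall x, f x < K -> exists e : posreal, forall z, Rabs (z - x) < e -> f z < K).
  { intros x Hx. apply (Hc x (fun v => v < K)). now apply open_lt. }
  destruct (completeness (fun t => p <= t <= q /\ forall z, p <= z <= t -> f z < K))
    as [b [Hub Hlub]].
  - exists q. intros t Ht. lra.
  - exists p. split; [lra|]. intros z Hz. now replace z with p by lra.
  - assert (Hbq : b <= q) by (apply Hlub; intros t Ht; lra).
    assert (Hlt : forall z, p <= z < b -> f z < K).
    { intros z Hz. apply Rnot_le_lt. intros Hn.
      assert (b <= z); [|lra]. apply Hlub. intros t [Ht1 Ht2].
      apply Rnot_lt_le. intros Htz. specialize (Ht2 z). lra. }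
    assert (Hpb : p < b).
    { destruct (Hopen p Hp) as [e He]. assert (He0 := cond_pos e).
      assert (p + Rmin (e / 2) (q - p) <= b).
      { assert (H1 := Rmin_l (e / 2) (q - p)). assert (H2 := Rmin_r (e / 2) (q - p)).
        assert (H3 : 0 < Rmin (e / 2) (q - p)) by (apply Rmin_pos; lra).
        apply Hub. split; [lra|]. intros z Hz. apply He. apply Rabs_def1; lra. }
      assert (0 < Rmin (e / 2) (q - p)) by (apply Rmin_pos; lra). lra. }
    exists b. split; [lra|]. split; [exact Hlt|].
    apply Rnot_lt_le. intros Hb.
    assert (b <> q) by (intros ->; lra).
    destruct (Hopen b Hb) as [e He]. assert (He0 := cond_pos e).
    assert (H1 := Rmin_l (e / 2) (q - b)). assert (H2 := Rmin_r (e / 2) (q - b)).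
    assert (H3 : 0 < Rmin (e / 2) (q - b)) by (apply Rmin_pos; lra).
    assert (b + Rmin (e / 2) (q - b) <= b); [|lra].
    apply Hub. split; [lra|]. intros z Hz.
    destruct (Rlt_dec z b); [apply Hlt; lra|]. apply He. apply Rabs_def1; lra.
Qed.

Lemma offset_sol_continuous (V : R -> R) : offset_sol V -> forall x, continuous V x.
Proof.
  intros HV x. apply (ex_derive_continuous (V := R_NormedModule)). eexists. apply HV.
Qed.

(** Names the right-hand side as a function of two arguments, the form that [is_derive_glue]
    takes. *)
Definition offset_field (z v : R) : R := Rabs z - Rabs (z - v).

(** * Global nonnegative solutions assembled from the branches *)

(** The threshold [exp 1 - 2] is the amplitude whose middle branch touches the diagonal at [z = 1];
    above it, [exp (1 - z) >= 2 - z] keeps the middle branch over the diagonal for good. *)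
Lemma offset_sol_far (u0 : R) : exp 1 - 2 <= u0 ->
  exists V, offset_sol V /\ (forall z, z <= 0 -> V z = u0 * exp (- z)) /\
    (forall z, 0 <= z -> z <= V z).
Proof.
  intros Hu. assert (He := exp_ineq1 1 R1_neq_R0).
  assert (Hm : forall z, 0 <= z -> z <= 2 * (z - 1) + (u0 + 2) * exp (- z)).
  { intros z Hz. assert (H := exp_ineq1_le (1 - z)).
    assert (exp (1 - z) <= (u0 + 2) * exp (- z)); [|lra].
    unfold Rminus. rewrite exp_plus. apply Rmult_le_compat_r; [left; apply exp_pos | lra]. }
  exists (fun z => if Rle_dec z 0 then u0 * exp (- z) else 2 * (z - 1) + (u0 + 2) * exp (- z)).
  split; [|split].
  - intros t. apply (is_derive_glue offset_field (fun z => u0 * exp (- z))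
      (fun z => 2 * (z - 1) + (u0 + 2) * exp (- z))).
    + intros H. apply is_derive_decay_branch; lra.
    + intros H. apply is_derive_middle_branch; auto.
    + rewrite Ropp_0, exp_0. ring.
  - intros z Hz. destruct (Rle_dec z 0); [reflexivity|lra].
  - intros z Hz. destruct (Rle_dec z 0); [|auto].
    assert (0 <= u0 * exp (- z)) by (apply Rmult_le_pos; [lra | left; apply exp_pos]). lra.
Qed.

(** [(2 - s) exp s - 2] is the value at [z = 0] of the solution whose middle branch meets the
    diagonal at [s]. *)
Lemma decay_amplitude_bounds (s : R) : 0 < s < 1 -> 0 < (2 - s) * exp s - 2 <= s.
Proof.
  intros Hs.
  assert (Hinv := exp_mul_opp).
  assert (Hp := exp_pos s). specialize (Hinv s) as Hi.
  split.
  (* The chord over [[-1, 0]] and [exp (-1) < 1/2] give [exp (- s) < 1 - s / 2], which is the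
     positivity claim after multiplication by [2 exp s]. *)
  - assert (H := exp_chord (-1) (- s) 0 ltac:(lra)). rewrite exp_0 in H.
    assert (He := exp_ineq1 1 R1_neq_R0). assert (Hi1 := Hinv 1).
    assert (Hp1 := exp_pos (-1)).
    assert (Hlt := Rmult_lt_compat_r (exp (-1)) _ _ Hp1 He). change (- (1)) with (-1) in Hi1.
    assert (exp (-1) < 1 / 2) by lra.
    assert (Hd : exp (- s) < 1 - s / 2) by nra.
    apply (Rmult_lt_compat_l (exp s)) in Hd; lra.
  (* This function vanishes at 0; its nonnegativity at [s], multiplied by [exp s], is the upper
     bound. *)
  - assert (H : (2 + 0) * exp (- 0) + 0 - 2 <= (2 + s) * exp (- s) + s - 2).
    { apply (nondecreasing_of_derive (fun r => (2 + r) * exp (- r) + r - 2)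
               (fun r => 1 - (1 + r) * exp (- r))); [lra | |].
      - intros r _. auto_derive; [auto | ring].
      - intros r Hr. assert (H := exp_ineq1_le r). assert (H' := exp_pos (- r)).
        specialize (Hinv r). nra. }
    rewrite Ropp_0, exp_0 in H. nra.
Qed.

(** The growth branch is convex and starts on the diagonal at [s]. It is below the diagonal at 1 and
    above it far away, so it returns at some [r > 1], and convexity keeps it below in between. *)
Lemma diagonal_return (s : R) : 0 < s < 1 ->
  exists r, 1 < r /\ s * exp (- s) * exp r = r /\
    (forall z, s <= z <= r -> s * exp (- s) * exp z <= z).
Proof.
  intros Hs. set (h := fun z => s * exp (- s) * exp z - z).
  assert (Hi := exp_mul_opp s).
  assert (HB : 0 < s * exp (- s)) by (apply Rmult_lt_0_compat; [lra | apply exp_pos]).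
  assert (H1 : h 1 < 0).
  { unfold h. rewrite Rmult_assoc, <- exp_plus.
    assert (H := exp_ineq1 (s - 1) (Rlt_not_eq (s - 1) 0 ltac:(lra))).
    assert (Hi' : exp (- s + 1) * exp (s - 1) = 1).
    { rewrite <- exp_plus. replace (- s + 1 + (s - 1)) with 0 by ring. apply exp_0. }
    assert (Hp := exp_pos (- s + 1)). nra. }
  (* With this [x], [s x^2 = 2 x], so the bound [exp (2 x) >= (1 + x)^2] suffices for
     [h (s + 2 x) >= 0]. *)
  set (x := 2 / s). assert (Hx : x * s = 2) by (unfold x; field; lra).
  assert (Hx2 : 2 < x) by nra.
  assert (Hq : 0 <= h (s + 2 * x)).
  { unfold h. rewrite exp_plus.
    replace (exp (2 * x)) with (exp x * exp x) by (rewrite <- exp_plus; f_equal; ring).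
    replace (s * exp (- s) * (exp s * (exp x * exp x)))
      with (s * (exp s * exp (- s)) * (exp x * exp x)) by ring.
    rewrite Hi. assert (H := exp_ineq1_le x).
    assert ((1 + x) * (1 + x) <= exp x * exp x) by (apply Rmult_le_compat; lra).
    assert (s * ((1 + x) * (1 + x)) <= s * (exp x * exp x)) by (apply Rmult_le_compat_l; lra).
    nra. }
  assert (Hcont : continuity h) by (unfold h; reg).
  destruct (IVT_gen h 1 (s + 2 * x) 0 Hcont) as [r [Hr Hr0]].
  { rewrite Rmin_left, Rmax_right by lra. lra. }
  rewrite Rmin_left, Rmax_right in Hr by lra.
  assert (r <> 1) by (intros ->; lra).
  exists r. split; [lra|]. split; [unfold h in Hr0; lra|].
  intros z Hz. unfold h in Hr0.
  assert (Hc := exp_chord s z r Hz).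
  apply (Rmult_le_compat_l (s * exp (- s))) in Hc; [|lra].
  assert (s * exp (- s) * exp s = s) by nra.
  assert ((r - s) * (s * exp (- s) * exp z) <= (r - s) * z); [|nra].
  replace ((r - s) * z) with ((r - z) * s + (z - s) * r) by ring. nra.
Qed.

(* The exponential branch is only valid up to the second crossing [r] of the
   diagonal; past it the solution stays above the diagonal. *)
Lemma offset_sol_near (s : R) : 0 < s < 1 ->
  exists V r, offset_sol V /\ 1 < r /\ s * exp (- s) * exp r = r /\
    (forall z, s <= z <= r -> s * exp (- s) * exp z <= z) /\
    (forall z, z <= 0 -> V z = ((2 - s) * exp s - 2) * exp (- z)) /\
    (forall z, 0 <= z <= s -> V z = 2 * (z - 1) + (2 - s) * exp s * exp (- z)) /\
    (forall z, s <= z <= r -> V z = s * exp (- s) * exp z) /\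
    (forall z, r <= z -> z <= V z) /\
    (forall z, 0 <= V z).
Proof.
  intros Hs. destruct (diagonal_return s Hs) as [r [Hr1 [Hr Hle]]].
  assert (Hinv := exp_mul_opp).
  assert (Hu := decay_amplitude_bounds s Hs).
  assert (HB : 0 < s * exp (- s)) by (apply Rmult_lt_0_compat; [lra | apply exp_pos]).
  (* The constants are forced by the values at the junctions: [s] at [s] for [f1] and [f2], [r] at
     [r] for [f3], and agreement with [f1] at 0 for [f0]. *)
  set (f0 := fun z => ((2 - s) * exp s - 2) * exp (- z)).
  set (f1 := fun z => 2 * (z - 1) + (2 - s) * exp s * exp (- z)).
  set (f2 := fun z => s * exp (- s) * exp z).
  set (f3 := fun z => 2 * (z - 1) + (2 - r) * exp r * exp (- z)).
  assert (H01 : f0 0 = f1 0) by (unfold f0, f1; rewrite Ropp_0, exp_0; ring).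
  assert (H12 : f1 s = f2 s).
  { unfold f1, f2. replace (s * exp (- s) * exp s) with (s * (exp s * exp (- s))) by ring.
    rewrite Rmult_assoc, Hinv. ring. }
  assert (H23 : f2 r = f3 r).
  { unfold f2, f3. rewrite Hr, Rmult_assoc, Hinv. ring. }
  assert (Hm1 : forall z, 0 <= z <= s -> z <= f1 z).
  { intros z Hz. unfold f1. rewrite Rmult_assoc, <- exp_plus.
    assert (H := exp_ineq1_le (s + - z)). nra. }
  assert (Hm3 : forall z, r <= z -> z <= f3 z).
  { intros z Hz. unfold f3. rewrite Rmult_assoc, <- exp_plus.
    (* The sign of [2 - r] decides whether the exponential must be bounded from below or from
       above. *)
    destruct (Rle_dec r 2).
    - assert (H := exp_ineq1_le (r + - z)). nra.
    - assert (H : exp (r + - z) <= exp 0).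
      { destruct (Req_dec r z); [right; f_equal; lra | left; apply exp_increasing; lra]. }
      rewrite exp_0 in H. nra. }
  assert (Hp2 : forall z, 0 <= f2 z)
    by (intros z; apply Rmult_le_pos; [lra | left; apply exp_pos]).
  assert (Hp0 : forall z, 0 <= f0 z)
    by (intros z; apply Rmult_le_pos; [lra | left; apply exp_pos]).
  set (g1 := fun z => if Rle_dec z 0 then f0 z else f1 z).
  set (g2 := fun z => if Rle_dec z s then g1 z else f2 z).
  set (V := fun z => if Rle_dec z r then g2 z else f3 z).
  assert (V0 : forall z, z <= 0 -> V z = f0 z).
  { intros z Hz. unfold V, g2, g1.
    destruct (Rle_dec z r), (Rle_dec z s), (Rle_dec z 0); reflexivity || lra. }
  assert (V1 : forall z, 0 <= z <= s -> V z = f1 z).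
  { intros z Hz. destruct (Req_dec z 0) as [->|]; [rewrite V0; lra|]. unfold V, g2, g1.
    destruct (Rle_dec z r), (Rle_dec z s), (Rle_dec z 0); reflexivity || lra. }
  assert (V2 : forall z, s <= z <= r -> V z = f2 z).
  { intros z Hz. destruct (Req_dec z s) as [->|]; [rewrite V1; lra|]. unfold V, g2.
    destruct (Rle_dec z r), (Rle_dec z s); reflexivity || lra. }
  assert (V3 : forall z, r <= z -> V z = f3 z).
  { intros z Hz. destruct (Req_dec z r) as [->|]; [rewrite V2; lra|]. unfold V.
    destruct (Rle_dec z r); reflexivity || lra. }
  exists V, r. split; [|repeat (split; [assumption || (intros; now auto)|])].
  - intros t. apply (is_derive_glue offset_field g2 f3).
    + intros Ht. apply (is_derive_glue offset_field g1 f2).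
      * intros Ht'. apply (is_derive_glue offset_field f0 f1).
        -- intros H. apply is_derive_decay_branch; lra.
        -- intros H. apply is_derive_middle_branch. split; [lra|]. apply Hm1; lra.
        -- exact H01.
      * intros H. apply is_derive_growth_branch. split; [apply Hp2 | apply Hle; lra].
      * rewrite <- H12. unfold g1. destruct (Rle_dec s 0); [lra|reflexivity].
    + intros H. apply is_derive_middle_branch. split; [lra|]. apply Hm3; lra.
    + rewrite <- H23. unfold g2. destruct (Rle_dec r s); [lra|reflexivity].
  - split; [intros z Hz; rewrite V3; auto|].
    intros z. destruct (Rle_dec z 0); [rewrite V0; auto|].
    destruct (Rle_dec z s); [rewrite V1 by lra; specialize (Hm1 z); lra|].
    destruct (Rle_dec z r); [rewrite V2 by lra; auto|].
    rewrite V3 by lra. specialize (Hm3 z). lra.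
Qed.

(** * Passages through the tube in the offset equation *)

Lemma exp_le_inv (x y : R) : exp x <= exp y -> x <= y.
Proof.
  intros H. apply Rnot_lt_le. intros Hxy. apply exp_increasing in Hxy. lra.
Qed.

(** All quantities are in units of [eps]. As [x = eps (z - V)], the condition [a < d] says that the
    entry abscissa is negative. *)
Definition offset_passage (D d a b : R) : Prop :=
  exists V, offset_sol V /\ a < 0 /\ a < d /\ V a = d /\ a < b /\
    (forall z, a < z < b -> Rabs (V z) < D) /\ D <= Rabs (V b).

(** The two solutions coincide, and the earlier exit would lie strictly inside the later passage. *)
Lemma offset_passage_unique (D d a b b' : R) :
  offset_passage D d a b -> offset_passage D d a b' -> b = b'.
Proof.
  intros [V [HV [_ [_ [Ha [Hab [Hin Hout]]]]]]] [W [HW [_ [_ [Ha' [Hab' [Hin' Hout']]]]]]].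
  assert (E : forall z, V z = W z) by (apply (offset_sol_unique V W a HV HW); congruence).
  destruct (Rtotal_order b b') as [H|[H|H]]; [|exact H|].
  - specialize (Hin' b ltac:(lra)). rewrite <- E in Hin'. lra.
  - specialize (Hin b' ltac:(lra)). rewrite E in Hin. lra.
Qed.

Lemma offset_sol_exit_bound (D a u0 : R) : 2 < D -> 0 < a -> u0 * exp a = D ->
  exists V Y, offset_sol V /\ (forall z, z <= 0 -> V z = u0 * exp (- z)) /\
    (forall z, 0 <= V z) /\ 0 < Y <= a + D /\ D <= V Y.
Proof.
  intros HD Ha Hu.
  assert (Hpa := exp_pos a). assert (Hu0 : 0 < u0) by nra.
  destruct (Rle_dec (exp 1 - 2) u0) as [Hfar|Hnear].
  - destruct (offset_sol_far u0 Hfar) as [V [HV [V0 V1]]].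
    exists V, D. split; [exact HV|]. split; [exact V0|]. split; [|split; [lra|apply V1; lra]].
    intros z. destruct (Rle_dec z 0); [|specialize (V1 z); lra].
    rewrite V0 by lra. apply Rmult_le_pos; [lra | left; apply exp_pos].
  (* The amplitude runs from 0 at [s = 0] to [exp 1 - 2] at [s = 1], so some crossing [s] realises
     [u0]. *)
  - assert (Hcont : continuity (fun s => (2 - s) * exp s - 2)) by reg.
    destruct (IVT_gen _ 0 1 u0 Hcont) as [s [Hs Hsu]].
    { rewrite exp_0, Rmin_left, Rmax_right by lra. lra. }
    rewrite Rmin_left, Rmax_right in Hs by lra.
    assert (s <> 0) by (intros ->; rewrite exp_0 in Hsu; lra).
    assert (s <> 1) by (intros ->; lra).
    assert (Hs' : 0 < s < 1) by lra.
    assert (Hb := decay_amplitude_bounds s Hs').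
    destruct (offset_sol_near s Hs') as [V [r [HV [Hr1 [Hr [_ [V0 [_ [V2 [V3 Vp]]]]]]]]]].
    rewrite Hsu in V0, Hb.
    exists V. destruct (Rlt_dec r D) as [HrD|HrD].
    + exists D. repeat (split; [assumption || lra|]). apply V3; lra.
    (* Here [D <= r], so the growth branch reaches [D] before its return: it does so at [s + l] with
       [l = ln (D / s)]. From [u0 <= s] follows [l <= a]. *)
    + assert (Hinv := exp_mul_opp s).
      assert (Hps := exp_pos (- s)).
      assert (Hln : s * exp (ln (D / s)) = D).
      { rewrite exp_ln; [field; lra | apply Rdiv_lt_0_compat; lra]. }
      set (l := ln (D / s)) in *.
      assert (Hl0 : 0 < l) by (apply exp_lt_inv; rewrite exp_0; nra).
      assert (Hla : l <= a) by (apply exp_le_inv; nra).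
      assert (HB : s * exp (- s) * exp (s + l) = D).
      { rewrite exp_plus. replace (s * exp (- s) * (exp s * exp l))
          with (exp s * exp (- s) * (s * exp l)) by ring. rewrite Hinv, Hln. ring. }
      assert (s + l <= r).
      { apply exp_le_inv. apply (Rmult_le_reg_l (s * exp (- s))); [|lra].
        apply Rmult_lt_0_compat; lra. }
      exists (s + l). repeat (split; [assumption || lra|]). rewrite V2 by lra. lra.
Qed.

Lemma upper_passage (D a : R) : 2 < D -> 0 < a ->
  exists b, offset_passage D D (- a) b /\ a - D <= b <= a + D.
Proof.
  intros HD Ha. set (u0 := D * exp (- a)).
  assert (Hu : u0 * exp a = D).
  { unfold u0. rewrite Rmult_assoc, <- exp_plus, Rplus_opp_l, exp_0. ring. }
  destruct (offset_sol_exit_bound D a u0 HD Ha Hu) as [V [Y [HV [V0 [Vp [HY HVY]]]]]].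
  assert (Hu0 : 0 < u0) by (apply Rmult_lt_0_compat; [lra | apply exp_pos]).
  assert (Hlow : forall z, - a < z <= 0 -> V z < D).
  { intros z Hz. rewrite V0, <- Hu by lra.
    apply Rmult_lt_compat_l; [exact Hu0|]. apply exp_increasing; lra. }
  assert (H0 : V 0 = u0) by (rewrite V0, Ropp_0, exp_0; lra).
  destruct (first_hitting V 0 Y D) as [b [Hb [Hin Hout]]];
    [apply offset_sol_continuous, HV | lra | apply Hlow; lra | exact HVY |].
  exists b. split.
  - exists V. split; [exact HV|]. split; [lra|]. split; [lra|]. split.
    + rewrite V0, Ropp_involutive by lra. exact Hu.
    + split; [lra|]. split; [|rewrite Rabs_pos_eq; auto].
      intros z Hz. rewrite Rabs_pos_eq by auto.
      destruct (Rle_dec z 0); [apply Hlow | apply Hin]; lra.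
  - split; [|lra].
    (* [u0 exp a = D <= V b <= u0 exp b]. *)
    assert (G := offset_growth V 0 b HV ltac:(lra)).
    rewrite !Rabs_pos_eq, H0, Rminus_0_r in G by auto.
    assert (a <= b); [|lra]. apply exp_le_inv. nra.
Qed.

(* The reversal [V z -> - V (- z)] turns this into tracing backwards an orbit
   that leaves through the upper side at ordinate [c]. *)
Lemma lower_passage (D c : R) : 2 < D -> D < c ->
  exists b, offset_passage D (- D) (- c) b /\ c - D <= b <= c + D.
Proof.
  intros HD Hc.
  (* A zero [s] of this function is the crossing whose growth branch has offset [D] at [z = c]; it
     lies below 1 because [exp (c - 1) >= c > D]. *)
  assert (Hcont : continuity (fun s => D * exp (s - c) - s)) by reg.
  assert (Hinv := exp_mul_opp).
  assert (H0 : 0 < D * exp (0 - c)) by (apply Rmult_lt_0_compat; [lra | apply exp_pos]).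
  assert (H1 : D * exp (1 - c) < 1).
  { assert (H := exp_ineq1_le (c - 1)). assert (Hi := Hinv (1 - c)).
    replace (- (1 - c)) with (c - 1) in Hi by ring. assert (Hp := exp_pos (1 - c)). nra. }
  destruct (IVT_gen _ 0 1 0 Hcont) as [s [Hs Hs0]].
  { rewrite Rmin_right, Rmax_left by lra. lra. }
  rewrite Rmin_left, Rmax_right in Hs by lra.
  assert (s <> 0) by (intros ->; lra).
  assert (s <> 1) by (intros ->; lra).
  assert (Hs' : 0 < s < 1) by lra.
  assert (HB : s * exp (- s) * exp c = D).
  { assert (E : s = D * exp (s - c)) by lra. rewrite E at 1.
    rewrite !Rmult_assoc, <- !exp_plus. replace (s - c + (- s + c)) with 0 by ring.
    rewrite exp_0. ring. }
  assert (Hb := decay_amplitude_bounds s Hs').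
  destruct (offset_sol_near s Hs') as [V [r [HV [Hr1 [Hr [_ [V0 [V1 [V2 [_ Vp]]]]]]]]]].
  assert (HBp : 0 < s * exp (- s)) by (apply Rmult_lt_0_compat; [lra | apply exp_pos]).
  assert (HBs : s * exp (- s) * exp s = s).
  { rewrite Rmult_assoc, (Rmult_comm (exp (- s))), Hinv. ring. }
  (* If [c] came after [r], convexity would put the point of the growth branch at [r] under a chord
     that is strictly below the diagonal, since [D < c]. *)
  assert (Hcr : c <= r).
  { apply Rnot_lt_le. intros Hrc. assert (Hch := exp_chord s r c ltac:(lra)).
    apply (Rmult_le_compat_l (s * exp (- s))) in Hch; [|lra].
    replace (s * exp (- s) * ((c - s) * exp r)) with ((c - s) * r) in Hch
      by (rewrite <- Hr at 1; ring).
    replace (s * exp (- s) * ((c - r) * exp s + (r - s) * exp c))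
      with ((c - r) * s + (r - s) * D) in Hch by (rewrite <- HB, <- HBs at 1; ring).
    nra. }
  set (u0 := (2 - s) * exp s - 2) in *.
  assert (Hln : u0 * exp (ln (D / u0)) = D).
  { rewrite exp_ln; [field; lra | apply Rdiv_lt_0_compat; lra]. }
  (* The decaying branch has offset [D] at [z = - b], which the reversal turns into the exit
     ordinate. *)
  set (b := ln (D / u0)) in *.
  assert (Hb0 : 0 < b) by (apply exp_lt_inv; rewrite exp_0; nra).
  assert (Hbc : b <= c).
  { assert (G := offset_growth V 0 c HV ltac:(lra)).
    rewrite !Rabs_pos_eq, (V0 0), (V2 c), HB, Rminus_0_r, Ropp_0, exp_0 in G by (auto || lra).
    apply exp_le_inv. nra. }
  (* [exp (c - s) = D / s <= D / u0 = exp b], by [u0 <= s]. *)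
  assert (Hcb : c - s <= b).
  { apply exp_le_inv. replace (exp (c - s)) with (exp (- s) * exp c)
      by (rewrite <- exp_plus; f_equal; ring). assert (Hpb := exp_pos b). nra. }
  exists b. split; [|lra].
  exists (fun z => - V (- z)). split; [apply offset_sol_rev, HV|].
  split; [lra|]. split; [lra|]. split; [|split; [lra|split]].
  - rewrite Ropp_involutive, V2, HB by lra. reflexivity.
  - intros z Hz. rewrite Rabs_Ropp, Rabs_pos_eq by auto.
    destruct (Rle_dec 0 z).
    + rewrite V0, Ropp_involutive, <- Hln by lra.
      apply Rmult_lt_compat_l; [lra|]. apply exp_increasing; lra.
    + destruct (Rle_dec (- s) z).
      * rewrite V1, Ropp_involutive by lra.
        (* The middle branch is convex, so it is bounded by its chord from [u0] to [s], and both
           ends are below [D]. *)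
        assert (Hch := exp_chord (- s) z 0 ltac:(lra)).
        assert (Hes := exp_pos s).
        apply (Rmult_le_compat_l ((2 - s) * exp s)) in Hch; [|nra].
        rewrite exp_0 in Hch.
        replace ((2 - s) * exp s * ((0 - z) * exp (- s) + (z - - s) * 1))
          with ((2 - s) * (- z) + (z + s) * (u0 + 2)) in Hch.
        2:{ unfold u0. replace (2 - s) with ((2 - s) * (exp s * exp (- s))) at 1
              by (rewrite Hinv; ring). ring. }
        nra.
      * rewrite V2, <- HB by lra. apply Rmult_lt_compat_l; [lra|]. apply exp_increasing; lra.
  - rewrite Rabs_Ropp, Rabs_pos_eq, V0, Ropp_involutive by (auto; lra). lra.
Qed.

(** * Translation between the planar system and the offset equation *)

Lemma solution_of_offset (eps : R) (V : R -> R) : 0 < eps -> offset_sol V ->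
  is_solution eps 1 (fun t => (eps * (t - V t), eps * t)).
Proof.
  intros He HV t. simpl.
  assert (HD : forall r, Derive V r = Rabs r - Rabs (r - V r))
    by (intros r; apply is_derive_unique, HV).
  rewrite !Rabs_mult, (Rabs_pos_eq eps) by lra.
  split; auto_derive; trivial; [eexists; apply HV | rewrite HD; ring | ring].
Qed.

Lemma offset_of_solution (eps : R) (g : R -> R * R) : 0 < eps -> is_solution eps 1 g ->
  exists V, offset_sol V /\
    forall t, let z := t + snd (g 0) / eps in g t = (eps * (z - V z), eps * z).
Proof.
  intros He Hg.
  assert (HXY : exists X Y : R -> R, (forall t, g t = (X t, Y t)) /\
            (forall t, is_derive X t (Rabs (X t) - Rabs (Y t) + 1 * eps)) /\
            (forall t, is_derive Y t eps)).
  { exists (fun t => fst (g t)), (fun t => snd (g t)).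
    split; [intros t; apply surjective_pairing | split; intros t; apply Hg]. }
  destruct HXY as [X [Y [HXY [HX HY]]]]. rewrite HXY. simpl.
  assert (DX : forall t, Derive X t = Rabs (X t) - Rabs (Y t) + 1 * eps)
    by (intros t; apply is_derive_unique, HX).
  assert (DY : forall t, Derive Y t = eps) by (intros t; apply is_derive_unique, HY).
  set (c := Y 0 / eps).
  assert (EY : forall t, Y t = eps * (t + c)).
  { intros t.
    assert (K : forall t, is_derive (fun r => Y r - eps * r) t 0).
    { intros r. auto_derive; [eexists; apply HY|].
      rewrite DY. ring. }
    assert (Y t = Y 0 + eps * t); [|unfold c; rewrite H; field; lra].
    destruct (MVT_gen _ 0 t (fun _ => 0) (fun r _ => K r)) as [r [_ E]].
    - intros r _. apply derivable_continuous_pt. exists 0. apply is_derive_Reals, K.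
    - lra. }
  (* The shift by [c] replaces time by the scaled ordinate. *)
  exists (fun z => z - X (z - c) / eps). split.
  - intros z. assert (Ez : z - c + c = z) by ring.
    replace (z - (z - X (z - c) / eps)) with (X (z - c) / eps) by ring.
    auto_derive; [eexists; apply HX|].
    change (z + - c) with (z - c).
    rewrite DX, EY, Ez.
    unfold Rdiv. rewrite !Rabs_mult, (Rabs_pos_eq eps), (Rabs_pos_eq (/ eps));
      [field; lra | left; apply Rinv_0_lt_compat; lra | lra].
  - intros t. rewrite HXY, EY. replace (t + c - c) with t by ring. f_equal. field. lra.
Qed.

Lemma tube_offset (eps delta z v : R) : 0 < eps ->
  tube delta (eps * (z - v), eps * z) <-> Rabs v < delta / eps.
Proof.
  intros He. unfold tube. simpl.
  replace (eps * z - eps * (z - v)) with (eps * v) by ring.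
  rewrite Rabs_mult, (Rabs_pos_eq eps) by lra.
  rewrite (Rmult_comm eps), <- Rlt_div_r by lra. reflexivity.
Qed.

Lemma passage_offset (eps delta d yi yo : R) : 0 < eps ->
  passage eps 1 delta d yi yo <->
  offset_passage (delta / eps) (d / eps) (yi / eps) (yo / eps).
Proof.
  intros He. assert (Hne : eps <> 0) by lra. split.
  - intros [g [ti [tf [Hg [[Hx [Hy E]] [[Hlt [Hin Hout]] [Hyi Hyo]]]]]]].
    destruct (offset_of_solution eps g He Hg) as [V [HV Hgt]].
    set (c := snd (g 0) / eps) in *. cbv zeta in Hgt.
    rewrite Hgt in Hx, Hy, E, Hyi, Hyo, Hout. simpl in Hx, Hy, E, Hyi, Hyo.
    rewrite tube_offset in Hout by exact He.
    assert (Ei : yi / eps = ti + c) by (rewrite <- Hyi; field; exact Hne).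
    assert (Eo : yo / eps = tf + c) by (rewrite <- Hyo; field; exact Hne).
    assert (Ed : d / eps = V (ti + c)).
    { replace d with (eps * V (ti + c)) by lra. field. exact Hne. }
    rewrite Ei, Eo, Ed. exists V. split; [exact HV|].
    split; [nra|]. split; [nra|]. split; [reflexivity|]. split; [lra|]. split; [|lra].
    intros z Hz. specialize (Hin (z - c) ltac:(lra)).
    rewrite Hgt, tube_offset in Hin by exact He.
    now replace (z - c + c) with z in Hin by ring.
  - intros [V [HV [Ha [Had [Hd [Hab [Hin Hout]]]]]]].
    exists (fun t => (eps * (t - V t), eps * t)), (yi / eps), (yo / eps).
    split; [now apply solution_of_offset|].
    split; [|split; [split; [exact Hab|]|simpl; split; field; exact Hne]].
    + unfold entry_point. simpl. rewrite Hd.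
      split; [nra|]. split; [nra|]. field. exact Hne.
    + split; [intros t Ht; rewrite tube_offset; auto|]. rewrite tube_offset by exact He. lra.
Qed.

(** * Existence, uniqueness and bounds of the way-in/way-out function *)

Lemma passage_unique (eps delta d yi yo yo' : R) : 0 < eps ->
  passage eps 1 delta d yi yo -> passage eps 1 delta d yi yo' -> yo = yo'.
Proof.
  intros He H H'. apply passage_offset in H, H'; [|exact He..].
  assert (E := offset_passage_unique _ _ _ _ _ H H').
  apply (Rmult_eq_reg_r (/ eps)); [exact E|]. apply Rinv_neq_0_compat. lra.
Qed.

(** An entry at ordinate [- a] has abscissa [- a - d]: for [d = - delta] this is negative only if
    [a > delta]. *)
Lemma entry_domain_iff (d a : R) : entry_domain d a <-> 0 < a /\ - d < a.
Proof.
  split.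
  - intros [p [[Hx [Hy E]] ->]]. rewrite Rabs_left by exact Hy. lra.
  - intros H. exists (- a - d, - a). unfold entry_point. simpl.
    rewrite Rabs_left; lra.
Qed.

Lemma passage_exists (eps delta d a : R) : 0 < eps -> 2 * eps < delta ->
  d = delta \/ d = - delta -> entry_domain d a ->
  exists b, passage eps 1 delta d (- a) b /\ a - delta <= b <= a + delta.
Proof.
  intros He Hdelta Hd Ha. apply entry_domain_iff in Ha.
  assert (HD : 2 < delta / eps) by (apply Rlt_div_r; lra).
  assert (Ha0 : 0 < a / eps) by (apply Rdiv_lt_0_compat; lra).
  assert (K : exists b, offset_passage (delta / eps) (d / eps) (- (a / eps)) b /\
            a / eps - delta / eps <= b <= a / eps + delta / eps).
  { destruct Hd as [-> | ->].
    - now apply upper_passage.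
    - unfold Rdiv at 2. rewrite Ropp_mult_distr_l_reverse.
      apply lower_passage; [exact HD|].
      apply Rmult_lt_compat_r; [apply Rinv_0_lt_compat|]; lra. }
  destruct K as [b [Hb Hbd]]. exists (eps * b). split.
  - apply passage_offset; [exact He|].
    replace (- a / eps) with (- (a / eps)) by (field; lra).
    now replace (eps * b / eps) with b by (field; lra).
  - replace a with (eps * (a / eps)) by (field; lra).
    replace delta with (eps * (delta / eps)) by (field; lra).
    rewrite <- Rmult_minus_distr_l, <- Rmult_plus_distr_l.
    split; apply Rmult_le_compat_l; lra.
Qed.

Lemma passage_entry (eps lam delta d yi yo : R) :
  passage eps lam delta d yi yo -> yi < 0 /\ entry_domain d (Rabs yi).
Proof.
  intros [g [ti [tf [_ [Hent [_ [<- _]]]]]]].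
  split; [apply Hent | now exists (g ti)].
Qed.

Lemma passage_bound (eps delta d yi yo : R) : 0 < eps -> 2 * eps < delta ->
  d = delta \/ d = - delta -> passage eps 1 delta d yi yo ->
  Rabs yi - delta <= yo <= Rabs yi + delta.
Proof.
  intros He Hdelta Hd H. destruct (passage_entry _ _ _ _ _ _ H) as [Hyi Hdom].
  destruct (passage_exists eps delta d _ He Hdelta Hd Hdom) as [b [Hb Hbd]].
  replace (- Rabs yi) with yi in Hb by (rewrite Rabs_left; lra).
  now rewrite (passage_unique eps delta d yi yo b He H Hb).
Qed.

(** Existence of a passage validates the choice of exit ordinate; uniqueness makes the passage
    relation its graph. *)
Lemma way_in_way_out_exists (eps delta d : R) : 0 < eps -> 2 * eps < delta ->
  d = delta \/ d = - delta ->
  exists Z, is_way_in_way_out eps 1 delta d Z /\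
    (forall a, entry_domain d a -> a - delta <= Z a <= a + delta).
Proof.
  intros He Hdelta Hd.
  (* Arbitrary outside the entry domain. *)
  set (Z := fun a => epsilon (inhabits 0) (fun b => passage eps 1 delta d (- a) b)).
  assert (HZ : forall a, entry_domain d a -> passage eps 1 delta d (- a) (Z a)).
  { intros a Ha. apply epsilon_spec.
    destruct (passage_exists eps delta d a He Hdelta Hd Ha) as [b [Hb _]]. now exists b. }
  exists Z. split.
  - intros a b. split.
    + intros [yi [-> H]]. destruct (passage_entry _ _ _ _ _ _ H) as [Hyi Hdom].
      split; [exact Hdom|]. specialize (HZ _ Hdom).
      replace (- Rabs yi) with yi in HZ by (rewrite Rabs_left; lra).
      exact (passage_unique eps delta d yi _ _ He H HZ).
    + intros [Ha ->]. exists (- a). split; [|auto].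
      apply entry_domain_iff in Ha. rewrite Rabs_left; lra.
  - intros a Ha. assert (H := passage_bound _ _ _ _ _ He Hdelta Hd (HZ a Ha)).
    apply entry_domain_iff in Ha. rewrite Rabs_Ropp, Rabs_pos_eq in H by lra. exact H.
Qed.

(** * End points of the branches and the orbit through the origin *)

(** The sign [sigma] treats both branches at once. A limit of the ray is on the diagonal with
    [sigma x >= 0], and being outside the ray leaves only the origin. *)
Lemma end_point_diagonal_ray (S : R * R -> Prop) (sigma : R) :
  sigma = 1 \/ sigma = -1 ->
  (forall p, S p <-> snd p = fst p /\ 0 < sigma * fst p) ->
  forall p, end_point S p <-> p = (0, 0).
Proof.
  intros Hsigma HS p. split.
  - intros [Hn Hcl]. destruct p as [x y]. rewrite HS in Hn. simpl in Hn.
    assert (Hball : forall e : posreal,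
              exists z, Rabs (z - x) < e /\ Rabs (z - y) < e /\ 0 < sigma * z).
    { intros e. destruct (Hcl _ (locally_ball (x, y) e)) as [[q1 q2] [[B1 B2] Hq]].
      apply HS in Hq. simpl in Hq, B1, B2. destruct Hq as [-> Hq].
      exists q1. now split. }
    assert (Exy : y = x).
    { apply NNPP. intros Hne.
      assert (Hr : 0 < Rabs (x - y) / 2)
        by (apply Rdiv_lt_0_compat; [apply Rabs_pos_lt|]; lra).
      destruct (Hball (mkposreal _ Hr)) as [z [H1 [H2 _]]]. simpl in H1, H2.
      rewrite Rabs_minus_sym in H1.
      assert (H := Rabs_triang (x - z) (z - y)).
      replace (x - z + (z - y)) with (x - y) in H by ring. lra. }
    subst y.
    assert (Hx : sigma * x <= 0) by (apply Rnot_lt_le; intros H; apply Hn; auto).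
    assert (Ex : x = 0).
    { apply NNPP. intros Hne.
      assert (Hr : 0 < Rabs x) by (apply Rabs_pos_lt; lra).
      destruct (Hball (mkposreal _ Hr)) as [z [H1 [_ H2]]]. simpl in H1.
      apply Rabs_def2 in H1. destruct Hsigma as [-> | ->].
      - rewrite Rabs_left in H1; lra.
      - rewrite Rabs_pos_eq in H1; lra. }
    now rewrite Ex.
  - intros ->. split; [rewrite HS; simpl; lra|].
    intros P [e He]. assert (He0 := cond_pos e).
    assert (Hs : Rabs (sigma * (e / 2)) < e).
    { rewrite Rabs_mult, (Rabs_pos_eq (e / 2)) by lra.
      destruct Hsigma as [-> | ->]; [rewrite Rabs_R1 | rewrite Rabs_left]; lra. }
    exists (sigma * (e / 2), sigma * (e / 2)). split.
    + apply He. split; unfold ball; simpl; unfold AbsRing_ball, abs, minus, plus, opp; simpl;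
        now rewrite Ropp_0, Rplus_0_r.
    + apply HS. simpl. split; [reflexivity|]. destruct Hsigma as [-> | ->]; lra.
Qed.

Lemma Sa_minus_1 (eps : R) (p : R * R) :
  Sa_minus eps 1 p <-> snd p = fst p /\ 0 < -1 * fst p.
Proof.
  unfold Sa_minus. replace (eps * (1 - 1)) with 0 by ring.
  rewrite Rmin_left by lra. lra.
Qed.

Lemma Sr_plus_1 (eps : R) (p : R * R) :
  Sr_plus eps 1 p <-> snd p = fst p /\ 0 < 1 * fst p.
Proof.
  unfold Sr_plus. replace (eps * (1 - 1)) with 0 by ring.
  rewrite Rmax_left by lra. lra.
Qed.

(** The offset vanishes at [z = 0], hence everywhere by uniqueness. *)
Lemma solution_through_origin (eps : R) (g : R -> R * R) : 0 < eps ->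
  is_solution eps 1 g -> g 0 = (0, 0) -> forall t, g t = (eps * t, eps * t).
Proof.
  intros He Hg H0 t. destruct (offset_of_solution eps g He Hg) as [V [HV Hgt]].
  assert (Ec : snd (g 0) / eps = 0) by (rewrite H0; simpl; field; lra).
  rewrite Ec in Hgt. cbv zeta in Hgt.
  assert (V0 : V 0 = 0).
  { specialize (Hgt 0). rewrite H0, Rplus_0_r in Hgt. injection Hgt as E _. nra. }
  rewrite Hgt, (offset_sol_unique V (fun _ => 0) 0 HV offset_sol_zero V0).
  now rewrite Rplus_0_r, Rminus_0_r.
Qed.

Lemma orbit_origin (eps : R) (p : R * R) : 0 < eps ->
  orbit eps 1 (0, 0) p <-> snd p = fst p.
Proof.
  intros He. split.
  - intros [g [t [Hg [H0 <-]]]]. now rewrite (solution_through_origin eps g He Hg H0).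
  - destruct p as [x y]. simpl. intros ->.
    exists (fun t => (eps * (t - 0), eps * t)), (x / eps).
    split; [exact (solution_of_offset eps _ He offset_sol_zero)|].
    split; f_equal; field; lra.
Qed.

Theorem theorem3p7 (eps : R) (Heps : 0 < eps) :
  ((forall p : R * R, end_point (Sa_minus eps 1) p <-> p = (0, 0)) /\
   (forall p : R * R, end_point (Sr_plus eps 1) p <-> p = (0, 0)) /\
   (forall p : R * R, orbit eps 1 (0, 0) p <->
      (Sa_minus eps 1 p \/ p = (0, 0) \/ Sr_plus eps 1 p))) /\
  (forall delta : R, 0 < delta ->
     (forall p q : R * R, end_point (Sa_minus eps 1) p ->
        orbit eps 1 p q -> tube delta q) /\
     maximal_delay eps 1 delta = p_infty) /\
  (forall delta d : R, 2 * eps < delta -> d = delta \/ d = - delta ->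
     (forall yi yo : R, passage eps 1 delta d yi yo ->
        Rabs yi - delta <= yo <= Rabs yi + delta) /\
     exists Z : R -> R,
       is_way_in_way_out eps 1 delta d Z /\
       (forall a : R, entry_domain d a -> a - delta <= Z a <= a + delta) /\
       is_lim Z p_infty p_infty /\
       ~ (exists M : R, forall a : R, entry_domain d a -> Rabs (Z a) <= M)).
Proof.
  assert (Ha : forall p, end_point (Sa_minus eps 1) p <-> p = (0, 0))
    by (apply (end_point_diagonal_ray _ (-1)); [now right | apply Sa_minus_1]).
  split; [split; [exact Ha|split]|split].
  - apply (end_point_diagonal_ray _ 1); [now left | apply Sr_plus_1].
  - intros p. rewrite orbit_origin, Sa_minus_1, Sr_plus_1 by exact Heps.
    destruct p as [x y]. simpl. split.
    + intros ->. destruct (total_order_T x 0) as [[H|H]|H]; [left | right; left | right; right].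
      * lra.
      * now rewrite H.
      * lra.
    + intros [[H _]|[H|[H _]]]; [exact H | congruence | exact H].
  - intros delta Hdelta.
    assert (Htube : forall x, tube delta (x, x))
      by (intros x; unfold tube; simpl; rewrite Rminus_diag, Rabs_R0; exact Hdelta).
    split.
    + intros p q Hp Hq. apply Ha in Hp. subst p. apply orbit_origin in Hq; [|exact Heps].
      destruct q as [x y]. simpl in Hq. subst y. apply Htube.
    (* The set of exit ordinates is empty, so every extended real is a lower bound. *)
    + apply is_glb_Rbar_unique. split; [|intros [b| |] _; simpl; auto].
      intros y [p [g [t [Hp [Hg [H0 [[_ [_ Hout]] _]]]]]]].
      apply Ha in Hp. subst p. exfalso. apply Hout.
      rewrite (solution_through_origin eps g Heps Hg H0). apply Htube.
  - intros delta d Hdelta Hd.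
    split; [intros yi yo; now apply passage_bound|].
    destruct (way_in_way_out_exists eps delta d Heps Hdelta Hd) as [Z [HZ Hbd]].
    exists Z. split; [exact HZ|]. split; [exact Hbd|].
    assert (Hlarge : forall a, delta < a -> a - delta <= Z a).
    { intros a H. apply Hbd, entry_domain_iff. lra. }
    split.
    (* The first bound puts [a] in the entry domain of either side, the second gives
       [a - delta > M]. *)
    + apply is_lim_spec. intros M. exists (Rmax delta (M + delta)). intros a H.
      assert (H1 := Rmax_l delta (M + delta)). assert (H2 := Rmax_r delta (M + delta)).
      specialize (Hlarge a). lra.
    + intros [M HM]. set (a := delta + Rabs M + 1).
      assert (HM0 := Rabs_pos M). assert (HM1 := Rle_abs M).
      assert (Hdom : entry_domain d a) by (apply entry_domain_iff; unfold a; lra).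
      specialize (HM a Hdom). assert (H1 := Rle_abs (Z a)).
      assert (H2 := Hlarge a). unfold a in *. lra.
Qed.
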